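(* Let $\Bbbk$ be a field of characteristic zero, $n\in\mathbb N$, and $\varphi_n\colon\mathcal F_n\mathcal O\to\Bbbk$ a Lie algebra homomorphism. If $n=0$, the universal Whittaker module $M_{\varphi_0}$ is irreducible if and only if $\varphi_0(\mathcal U_2)\neq4\varphi_0(\mathcal U_0)$. If $n\ge1$, $M_{\varphi_n}$ is irreducible if and only if $\varphi_n(\mathcal U_{2n+1})\neq4\varphi_n(\mathcal U_{2n-1})$ or $\varphi_n(\mathcal U_{2n+2})\neq4\varphi_n(\mathcal U_{2n})$.
   Context: $\mathcal O$ is the Lie algebra with basis $\{\mathcal U_n\mid n\ge-1\}$ and bracket $[\mathcal U_n,\mathcal U_m]=(n-m)(\mathcal U_{n+m+2}-4\mathcal U_{n+m})$ (where $\mathcal U_{-2},\mathcal U_{-3}$ are interpreted as $0$); concretely $\mathcal U_n=-(t+t^{-1})^{n+1}(t^2-1)\partial$ inside the Witt algebra $\Bbbk[t,t^{-1}]\partial$, and $\mathcal O$ is the span of $L_k-L_{-k}$, $k\ge1$. For $n\in\mathbb N$, $\mathcal F_n\mathcal O=\mathrm{span}\{\mathcal U_k\mid k\ge n\}$ (a subalgebra). For a Lie algebra homomorphism $\varphi_n\colon\mathcal F_n\mathcal O\to\Bbbk$, let $\Bbbk_{\varphi_n}=\Bbbk1_{\varphi_n}$ with $x\cdot1_{\varphi_n}=\varphi_n(x)1_{\varphi_n}$, and $M_{\varphi_n}=\mathrm{Ind}_{\mathcal F_n\mathcal O}^{\mathcal O}\Bbbk_{\varphi_n}=U(\mathcal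 O)\otimes_{U(\mathcal F_n\mathcal O)}\Bbbk_{\varphi_n}$. *)

(* Defs.v *)
From HB Require Import structures.
From mathcomp Require Import all_boot all_order all_algebra.
Set Implicit Arguments. Unset Strict Implicit. Unset Printing Implicit Defensive.
Import Order.TTheory GRing.Theory Num.Theory.
Local Open Scope ring_scope.

(* The Lie algebra O has basis U_k, k >= -1 (indices are integers), with
   [U_n, U_m] = (n - m) (U_{n+m+2} - 4 U_{n+m}),  U_{-2} = U_{-3} = 0.
   A representation of O on a K-vector space V is given by the linear
   operators rho k = action of U_k (k >= -1) satisfying the bracket
   relations on basis elements (this is what a Lie algebra morphism
   O -> gl(V) unfolds to, O having basis (U_k)). *)

Section Defs.
Variable K : fieldType.

Definition actU (V : lmodType K) (rho : int -> V -> V) (k : int) (v : V) : V :=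
  if (-1 <= k)%R then rho k v else 0.

Definition is_Omodule (V : lmodType K) (rho : int -> V -> V) : Prop :=
  (forall k (a : K) (u v : V), rho k (a *: u + v) = a *: rho k u + rho k v) /\
  (forall (n m : int), -1 <= n -> -1 <= m -> forall v : V,
     rho n (rho m v) - rho m (rho n v)
     = (n - m)%:~R *: (actU rho (n + m + 2) v - 4 *: actU rho (n + m) v)).

Definition is_Ohom (V W : lmodType K) (rho : int -> V -> V) (sigma : int -> W -> W)
  (f : V -> W) : Prop :=
  (forall (a : K) (u v : V), f (a *: u + v) = a *: f u + f v) /\
  (forall (k : int) (v : V), -1 <= k -> f (rho k v) = sigma k (f v)).

Definition is_submodule (V : lmodType K) (rho : int -> V -> V) (S : V -> Prop) : Prop :=
  S 0 /\ (forall u v, S u -> S v -> S (u + v)) /\ (forall (a : K) u, S u -> S (a *: u)) /\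
  (forall (k : int) u, -1 <= k -> S u -> S (rho k u)).

Definition Oirreducible (V : lmodType K) (rho : int -> V -> V) : Prop :=
  (exists v : V, v != 0) /\
  forall S, is_submodule rho S -> (forall v, S v -> v = 0) \/ (forall v, S v).

(* A Lie algebra hom phi : F_n O -> K, given by its values phi k = phi(U_k),
   k >= n (values at k < n are irrelevant). Linear maps on F_n O correspond
   to such families; the Lie condition is phi([U_a,U_b]) = 0 for a,b >= n. *)
Definition is_Lie_hom_Fn (n : nat) (phi : nat -> K) : Prop :=
  forall a b : nat, (n <= a)%N -> (n <= b)%N ->
    (a%:R - b%:R) * (phi (a + b + 2)%N - 4 * phi (a + b)%N) = 0.

Definition is_Whittaker_vec (n : nat) (phi : nat -> K) (V : lmodType K)
  (rho : int -> V -> V) (v : V) : Prop :=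
  forall k : nat, (n <= k)%N -> rho (k%:Z) v = phi k *: v.

(* (M, rho, w) is the induced module Ind_{F_n O}^O K_phi, characterized by its
   universal property: for every O-module W and every w' in W on which F_n O acts
   by phi there is a unique O-module hom M -> W sending w to w'. *)
Definition is_universal_Whittaker (n : nat) (phi : nat -> K) (M : lmodType K)
  (rho : int -> M -> M) (w : M) : Prop :=
  is_Omodule rho /\ is_Whittaker_vec n phi rho w /\
  forall (W : lmodType K) (sigma : int -> W -> W) (w' : W),
    is_Omodule sigma -> is_Whittaker_vec n phi sigma w' ->
    exists f : M -> W, [/\ is_Ohom rho sigma f, f w = w' &
      forall g : M -> W, is_Ohom rho sigma g -> g w = w' -> forall x, g x = f x].

End Defs.

(* Main.v *)
Require Import Defs.
From HB Require Import structures.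
From mathcomp Require Import all_boot all_order all_algebra.
From mathcomp Require Import boolp functions.
From mathcomp Require Import ring zify.
Import Order.TTheory GRing.Theory Num.Theory.
Set Implicit Arguments. Unset Strict Implicit. Unset Printing Implicit Defensive.
Local Open Scope ring_scope.

(* Sending U_n to -s^(n+1) (s^2 - 4) d/ds identifies O with the vector fields
   (s^2 - 4) K[s] d/ds and F_n O with those vanishing to order n+1 at 0, so
   O = F_(-1) > F_0 > F_1 > ... is a chain of subalgebras, each of codimension
   one in the preceding one.

   Nonzero Whittaker vectors exist for every phi: coinducing the character -phi
   one step at a time along the chain gives an O-module C with a functional ev
   such that ev (x v) = - phi(x) ev(v) for x in F_n, that is, a Whittaker vector
   of type phi in the dual of C. If phi satisfies the excluded equalities, it
   extends to F_(n-1), and the kernel of a map from M to a module with a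
   Whittaker vector for the extension is a proper submodule containing
   U_(n-1) w - phi(U_(n-1)) w, which is nonzero.

   Conversely put V_k = U_(k+2) - 4 U_k and let c be the largest index with
   phi(V_c) <> 0, so that c = 2n or c = 2n - 1. By descending induction on k,
   every nonzero vector of U(F_k) w generates a submodule containing w: with
   e = U_k, U(F_k) w is the sum of the e^j U(F_(k+1)) w, and since [U_(c-k), e]
   is a nonzero multiple of V_c and V_j kills U(F_0) w for j > c, the operator
   U_(c-k) - phi(U_(c-k)) lowers the degree in e by exactly one. The case n = 0
   is special because [V_0, U_(-1)] involves U_(-1) itself: there the leading
   coefficient of U_1 - phi(U_1) can vanish, and U_2 - phi(U_2), which lowers
   the degree by two, takes over. *)

(** * Linear identities *)

Section LinearExpressions.
Variables (K : fieldType) (V : lmodType K).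

Inductive lexpr :=
  | LVar of nat
  | LZero
  | LAdd of lexpr & lexpr
  | LOpp of lexpr
  | LScale of K & lexpr.

Fixpoint leval (env : seq V) e : V :=
  match e with
  | LVar i => env`_i
  | LZero => 0
  | LAdd a b => leval env a + leval env b
  | LOpp a => - leval env a
  | LScale c a => c *: leval env a
  end.

Fixpoint lcoef e (i : nat) : K :=
  match e with
  | LVar j => (j == i)%:R
  | LZero => 0
  | LAdd a b => lcoef a i + lcoef b i
  | LOpp a => - lcoef a i
  | LScale c a => c * lcoef a i
  end.

Lemma leval_coef env e :
  leval env e = \sum_(i < size env) lcoef e i *: env`_i.
Proof.
elim: e => [j||a IHa b IHb|a IHa|c a IHa] /=.
- case: (ltnP j (size env)) => [lt_j|ge_j].
    rewrite (bigD1 (Ordinal lt_j)) //= eqxx scale1r big1 ?addr0 // => i ne_ij.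
    by rewrite eq_sym -(inj_eq val_inj) in ne_ij; rewrite (negPf ne_ij) scale0r.
  rewrite nth_default // big1 // => i _.
  by rewrite gtn_eqF ?scale0r // (leq_trans (ltn_ord i)).
- by rewrite big1 // => i _; rewrite scale0r.
- by rewrite IHa IHb -big_split /=; apply: eq_bigr => i _; rewrite scalerDl.
- by rewrite IHa -sumrN; apply: eq_bigr => i _; rewrite scaleNr.
- by rewrite IHa scaler_sumr; apply: eq_bigr => i _; rewrite scalerA.
Qed.

(** A conjunction of equations in [K], one per atom, and not a boolean test: the coefficients are
    symbolic and are left to [ring]. *)
Fixpoint lcheck (n : nat) e1 e2 : Prop :=
  if n is i.+1 then lcoef e1 i = lcoef e2 i /\ lcheck i e1 e2 else True.

Lemma leval_eq env e1 e2 :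
  lcheck (size env) e1 e2 -> leval env e1 = leval env e2.
Proof.
move=> ck; rewrite !leval_coef; apply: eq_bigr => -[i /= lt_i] _.
congr (_ *: _); move: (size env) ck i lt_i; elim=> //= n IH [e12 ck] i.
by rewrite ltnS leq_eqVlt => /predU1P[-> | /(IH ck)].
Qed.

End LinearExpressions.

Ltac lmem v env :=
  lazymatch env with
  | nil => false
  | v :: _ => true
  | _ :: ?env' => lmem v env'
  end.

Ltac lfind v env :=
  lazymatch env with
  | v :: _ => constr:(0%N)
  | _ :: ?env' => let i := lfind v env' in constr:(i.+1)
  end.

Ltac lvars t env :=
  lazymatch t with
  | (?a + ?b)%R => let env' := lvars a env in lvars b env'
  | (- ?a)%R => lvars a env
  | (_ *: ?a)%R => lvars a env
  | 0%R => env
  | _ => lazymatch lmem t env with true => env | false => constr:(t :: env) end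
  end.

Ltac lreify K t env :=
  lazymatch t with
  | (?a + ?b)%R =>
      let a' := lreify K a env in let b' := lreify K b env in
      constr:(LAdd a' b')
  | (- ?a)%R => let a' := lreify K a env in constr:(LOpp a')
  | (?c *: ?a)%R => let a' := lreify K a env in constr:(@LScale K c a')
  | 0%R => constr:(@LZero K)
  | _ => let i := lfind t env in constr:(@LVar K i)
  end.

(* Decides linear identities between vectors, leaving the comparison of
   coefficients to [ring]. *)
Ltac lin K :=
  lazymatch goal with
  | |- @eq ?V ?a ?b =>
      let env0 := constr:(@nil V) in
      let env1 := lvars a env0 in
      let env := lvars b env1 in
      let ea := lreify K a env in
      let eb := lreify K b env in
      apply: (@leval_eq K _ env ea eb); rewrite /=;
      repeat (first [exact: I | split; first by ring])
  end.

Section LinearMaps.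
Variables (K : fieldType) (U V : lmodType K).

Definition is_lin (f : U -> V) :=
  forall (a : K) (u v : U), f (a *: u + v) = a *: f u + f v.

Variable f : U -> V.
Hypothesis fP : is_lin f.

Lemma is_lin0 : f 0 = 0.
Proof. by have := fP (-1) 0 0; rewrite !scaleN1r !addNr. Qed.

Lemma is_linD u v : f (u + v) = f u + f v.
Proof. by rewrite -[u]scale1r fP !scale1r. Qed.

Lemma is_linZ a u : f (a *: u) = a *: f u.
Proof. by rewrite -[a *: u]addr0 fP is_lin0 addr0. Qed.

Lemma is_linN u : f (- u) = - f u.
Proof. by rewrite -scaleN1r is_linZ scaleN1r. Qed.

Lemma is_linB u v : f (u - v) = f u - f v.
Proof. by rewrite is_linD is_linN. Qed.

End LinearMaps.

(** * Existence of Whittaker vectors *)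

Section Submodules.
Variables (K : fieldType) (V : lmodType K).

(** Classical subspaces; [sub_of] makes them modules in their own right, as needed for the dual
    space and for the submodule generated by w. *)
Record subsp := Subsp {
  smem :> V -> Prop;
  _ : smem 0;
  _ : forall a u v, smem u -> smem v -> smem (a *: u + v) }.

Definition subsp_pred (S : subsp) : {pred V} := fun v => `[< S v >].

Lemma subsp_predP (S : subsp) v : reflect (S v) (v \in subsp_pred S).
Proof. exact: asboolP. Qed.

Lemma subsp_closed (S : subsp) : submod_closed (subsp_pred S).
Proof.
case: S => P P0 PD; split; first exact/asboolP.
by move=> a u v /asboolP Pu /asboolP Pv; apply/asboolP/PD.
Qed.

HB.instance Definition _ S :=
  GRing.isSubmodClosed.Build K V (subsp_pred S) (subsp_closed S).

Record sub_of (S : subsp) := SubOf { sub_val : V; _ : sub_val \in subsp_pred S }.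
HB.instance Definition _ S := [isSub for @sub_val S].
HB.instance Definition _ S := [Choice of sub_of S by <:].
HB.instance Definition _ S := [SubChoice_isSubLmodule of sub_of S by <:].

End Submodules.

(** * Vector fields and representations of the subalgebras *)

Section VectorFields.
Variable K : fieldType.
Implicit Types (p q x y : {poly K}) (m : nat).

(* The polynomial p stands for the vector field - p(s) (s^2 - 4) d/ds, so 'X^i is
   the generator U_(i-1). *)
Definition br p q := (p^`() * q - p * q^`()) * ('X^2 - 4).

Lemma brC p q : br p q = - br q p.
Proof. rewrite /br; ring. Qed.

Lemma brZDl a p q x : br (a *: p + q) x = a *: br p x + br q x.
Proof. by rewrite /br derivD derivZ -!mul_polyC; ring. Qed.

Lemma brZDr a p q x : br x (a *: p + q) = a *: br x p + br x q.
Proof. by rewrite brC brZDl !(brC x) scalerN opprD. Qed.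

Lemma br_jacobi p q x : br p (br q x) = br (br p q) x + br q (br p x).
Proof.
by rewrite /br !(derivM, derivB, derivXn, derivC, derivD) /=; ring.
Qed.

Definition vanish m p := exists a, p = 'X^m * a.

Lemma vanish_br m p q : vanish m p -> vanish m q -> vanish m (br p q).
Proof.
case=> a -> [b ->]; exists ('X^m * (a^`() * b - a * b^`()) * ('X^2 - 4)).
by rewrite /br !derivM; ring.
Qed.

(** [r] is total on polynomials, but the bracket relation is required only on multiples of ['X^m]: a
    representation of F_(m-1) without a type for F_(m-1). *)
Definition is_rep m (V : lmodType K) (r : {poly K} -> V -> V) :=
  [/\ forall a p q v, r (a *: p + q) v = a *: r p v + r q v,
      forall p a u v, r p (a *: u + v) = a *: r p u + r p v &
      forall p q v, vanish m p -> vanish m q ->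
        r p (r q v) - r q (r p v) = r (br p q) v].

End VectorFields.

Lemma vanishP (K : fieldType) m (p : {poly K}) :
  vanish m p <-> forall i, (i < m)%N -> p`_i = 0.
Proof.
split=> [[a ->] i im|p0]; first by rewrite coefXnM im.
exists (drop_poly m p); rewrite -[LHS](poly_take_drop m) mulrC.
rewrite [take_poly m p](_ : _ = 0) ?add0r //.
by apply/polyP => i; rewrite coef_take_poly coef0; case: ifP => // /p0.
Qed.

(** * One step of coinduction *)

Section Coinduction.
Variables (K : fieldType) (m : nat) (V : lmodType K) (r : {poly K} -> V -> V).
Hypothesis rP : is_rep m.+1 r.
Implicit Types (p q x y : {poly K}) (f g : nat -> V).

Definition trim p := p - p`_m *: 'X^m.

Definition shift f : nat -> V := fun i => f i.+1.

(* [f j] is the value at e^j, for e = 'X^m, of a linear map U(P_m) -> V that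
   commutes with P_(m+1), where P_i = 'X^i K[X]; the recursion is e^(j+1) p = e^j p e + e^j [e, p]. *)
Fixpoint coind j p f : V :=
  if j is i.+1 then coind i p (shift f) + coind i (br 'X^m p) f
  else r (trim p) (f 0%N) + p`_m *: f 1%N.

Definition coind_act p f : nat -> V := fun j => coind j p f.

Lemma trimZD a p q : trim (a *: p + q) = a *: trim p + trim q.
Proof. by rewrite /trim coefD coefZ -!mul_polyC polyCD polyCM; ring. Qed.

Lemma trim_id p : p`_m = 0 -> trim p = p.
Proof. by rewrite /trim => ->; rewrite scale0r subr0. Qed.

Lemma vanish_trim p : vanish m p -> vanish m.+1 (trim p).
Proof.
move/vanishP=> p0; apply/vanishP => i; rewrite ltnS leq_eqVlt /trim.
case/predU1P => [->|im]; rewrite coefB coefZ coefXn; first by rewrite eqxx mulr1 subrr.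
by rewrite (p0 i) // ltn_eqF // mulr0 subrr.
Qed.

Lemma coindZDl j a p q f : coind j (a *: p + q) f = a *: coind j p f + coind j q f.
Proof.
elim: j p q f => [|j IH] p q f /=.
  case: rP => rl _ _; rewrite trimZD rl coefD coefZ scalerDl !scalerDr scalerA.
  by rewrite addrACA.
by rewrite IH brZDr IH !scalerDr addrACA.
Qed.

Lemma coindZDr j a p f g : coind j p (a *: f + g) = a *: coind j p f + coind j p g.
Proof.
elim: j p f g => [|j IH] p f g /=.
  case: rP => _ rr _; rewrite !fctE rr !scalerDr !scalerA (mulrC a).
  by rewrite addrACA.
by rewrite !IH !scalerDr addrACA.
Qed.

Lemma coindDl j p q f : coind j (p + q) f = coind j p f + coind j q f.
Proof. by rewrite -[p]scale1r coindZDl !scale1r. Qed.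

Lemma coindZl j a p f : coind j (a *: p) f = a *: coind j p f.
Proof.
have c0 : coind j 0 f = 0.
  by have := coindZDl j (-1) 0 0 f; rewrite !scaleN1r !addNr.
by rewrite -[a *: p]addr0 coindZDl c0 addr0.
Qed.

Lemma coindDr j p f g : coind j p (f + g) = coind j p f + coind j p g.
Proof. by rewrite -[f]scale1r coindZDr !scale1r. Qed.

(** [shift] is the action of ['X^m]; its commutation relation with [p] is built into the recursion
    of [coind]. *)
Lemma coind_act_shift p f :
  shift (coind_act p f) = coind_act p (shift f) + coind_act (br 'X^m p) f.
Proof. by apply/funext. Qed.

Lemma vanishXn : vanish m ('X^m : {poly K}).
Proof. by exists 1; rewrite mulr1. Qed.

Lemma br_trim x y :
  br x y = br (trim x) (trim y) + (x`_m *: br 'X^m y - y`_m *: br 'X^m x).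
Proof.
by rewrite /br /trim !derivB !derivZ -!mul_polyC; ring.
Qed.

(** For j = 0, splitting off the ['X^m] terms of x and y reduces to the relation for [r]; in the
    step, [coind_act_shift] expands both sides and the Jacobi identity matches them. *)
Lemma coind_br j x y f : vanish m x -> vanish m y ->
  coind j x (coind_act y f) - coind j y (coind_act x f) = coind j (br x y) f.
Proof.
elim: j x y f => [|j IH] x y f vx vy.
  case: rP => rl rr rb; have [vx' vy'] := (vanish_trim vx, vanish_trim vy).
  have vxy := vanish_br vx' vy'.
  have vxy' : (br (trim x) (trim y))`_m = 0 by move/vanishP: vxy; apply.
  rewrite br_trim coindDl -scaleNr coindDl !coindZl scaleNr.
  have -> : coind 0 (br (trim x) (trim y)) f = r (br (trim x) (trim y)) (f 0%N).
    by rewrite /= vxy' scale0r addr0 trim_id.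
  rewrite -rb //.
  have rrD p u a v : r p (u + a *: v) = r p u + a *: r p v by rewrite addrC rr addrC.
  by rewrite /= !rrD /shift /coind_act /=; lin K.
rewrite [coind j.+1 x _]/= [coind j.+1 y _]/= [coind j.+1 (br x y) _]/=.
rewrite !coind_act_shift !coindDr br_jacobi coindDl.
have vX := vanishXn; have [vXx vXy] := (vanish_br vX vx, vanish_br vX vy).
by rewrite -!IH //; lin K.
Qed.

End Coinduction.

Lemma coind_rep (K : fieldType) m (V : lmodType K) (r : {poly K} -> V -> V) :
  is_rep m.+1 r -> is_rep m (coind_act m r).
Proof.
move=> rP; split=> [a p q v|p a u v|p q v vp vq]; apply/funext => j.
- exact: coindZDl.
- exact: coindZDr.
- exact: coind_br.
Qed.

(** The bracket of U_(i-1) and U_(j-1). The predecessor is truncated only for i = j = 0, where the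
    factor i - j is zero. *)
Lemma brXn (K : fieldType) i j :
  br 'X^i 'X^j =
  (i%:R - j%:R) *: ('X^((i + j).+1) - 4 *: 'X^((i + j).-1)) :> {poly K}.
Proof.
have XnE k l : (k%:R *: 'X^(k.-1) : {poly K}) * 'X^l = k%:R *: 'X^((k + l).-1).
  by case: k => [|k]; rewrite ?scale0r ?mul0r // -scalerAl -exprD.
rewrite /br !derivXn -!scaler_nat XnE mulrC [X in _ * (_ - X)]mulrC XnE (addnC j).
rewrite -scalerBl -scalerAr; case: (posnP (i + j)%N) => [ij0|].
  by move: ij0 => /eqP; rewrite addn_eq0 => /andP[/eqP-> /eqP->]; rewrite subrr !scale0r.
by case: (i + j)%N => // k _; rewrite -!mul_polyC !exprS polyC_natr; ring.
Qed.

(** * Characters and iterated coinduction *)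

Section Character.
Variables (K : fieldType) (N : nat) (c : nat -> K).
Hypothesis cP : forall i j, (N <= i)%N -> (N <= j)%N ->
  (i%:R - j%:R) * (c (i + j).+1 - 4 * c (i + j).-1) = 0.

Definition chi (p : {poly K}) := \sum_(i < size p) p`_i * c i.

Lemma chiE k (p : {poly K}) : (size p <= k)%N -> chi p = \sum_(i < k) p`_i * c i.
Proof.
move=> le_pk; rewrite /chi (big_ord_widen k (fun i => p`_i * c i)) // big_mkcond.
apply: eq_bigr => i _; case: ltnP => // le_pi.
by rewrite nth_default ?mul0r.
Qed.

Lemma chiZD a p q : chi (a *: p + q) = a * chi p + chi q.
Proof.
have [le_p le_q] := (leq_maxl (size p) (size q), leq_maxr (size p) (size q)).
have le_pq : (size (a *: p + q)%R <= maxn (size p) (size q))%N.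
  rewrite (leq_trans (size_polyD _ _)) // geq_max le_q andbT.
  exact: leq_trans (size_scale_leq _ _) _.
rewrite (chiE le_p) (chiE le_q) (chiE le_pq) mulr_sumr -big_split /=.
by apply: eq_bigr => i _; rewrite coefD coefZ; ring.
Qed.

Lemma chi0 : chi 0 = 0.
Proof. by rewrite /chi size_poly0 big_ord0. Qed.

Lemma chiZ a p : chi (a *: p) = a * chi p.
Proof. by rewrite -[a *: p]addr0 chiZD chi0 addr0. Qed.

Lemma chiXn i : chi 'X^i = c i.
Proof.
rewrite (@chiE i.+1) ?size_polyXn // (bigD1 ord_max) //= coefXn eqxx mul1r.
rewrite big1 ?addr0 // => j ne_ji; rewrite coefXn.
by rewrite -(inj_eq val_inj) /= in ne_ji; rewrite (negPf ne_ji) mul0r.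
Qed.

Lemma chi_br p q : vanish N p -> vanish N q -> chi (br p q) = 0.
Proof.
(* A functional vanishing on the monomials of degree at least N vanishes on all multiples of ['X^N];
   this is applied to each argument of the bracket in turn. *)
have ext (f : {poly K} -> K) : (forall a u v, f (a *: u + v) = a * f u + f v) ->
    (forall i, (N <= i)%N -> f 'X^i = 0) -> forall p, vanish N p -> f p = 0.
  move=> fZD fX u /vanishP u0.
  have f0 : f 0 = 0 by have := fZD (-1) 0 0; rewrite scaleN1r addNr mulN1r addNr.
  rewrite -[u]coefK poly_def; elim/big_rec: _ => // i x _ fx0.
  rewrite fZD fx0 addr0; case: (ltnP i N) => [/u0-> | /fX->]; first by rewrite mul0r.
  exact: mulr0.
move=> vp vq; apply: (ext (fun p => chi (br p q))) vp => [a u v|i le_Ni].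
  by rewrite brZDl chiZD.
apply: (ext (fun q => chi (br 'X^i q))) vq => [a u v|j le_Nj].
  by rewrite brZDr chiZD.
rewrite brXn chiZ [X in chi X]addrC -scaleNr chiZD !chiXn.
by rewrite mulNr [- _ + _]addrC cP.
Qed.

(** Induction on N - m, starting from the line on which x acts by - chi(x). The last clause shows
    that [ev] is no eigenvector of U_(N-2) in the dual. *)
Lemma coinduced_functional m : (m <= N)%N ->
  exists (V : lmodType K) (r : {poly K} -> V -> V) (ev : V -> K),
  [/\ is_rep m r, (forall a u v, ev (a *: u + v) = a * ev u + ev v),
      (forall x v, vanish N x -> ev (r x v) = - chi x * ev v),
      (exists v, ev v = 1) &
      (m < N)%N -> exists2 v, ev v = 0 & ev (r 'X^(N.-1) v) = 1].
Proof.
move=> le_mN; rewrite -(subKn le_mN); elim: (N - m)%N (leq_subr m N) => [_|d IH lt_dN].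
  rewrite subn0; exists K^o, (fun x v => - chi x * v), id; split=> //.
  - split=> [a p q v|p a u v|p q v vp vq]; rewrite ?chiZD /GRing.scale /=; try by ring.
    by rewrite chi_br //; ring.
  - by exists 1.
  - by rewrite ltnn.
case: (IH (ltnW lt_dN)) => V [r [ev [rP evZD ev_chi [v1 ev1] ev_next]]].
set k := (N - d.+1)%N; have dk : (N - d)%N = k.+1 by rewrite /k -subSn.
rewrite dk in rP ev_next.
have evr x v : vanish N x -> ev (coind_act k r x v 0%N) = - chi x * ev (v 0%N).
  move=> vx; have xk : x`_k = 0 by move/vanishP: vx; apply; rewrite /k; lia.
  by rewrite /coind_act /= trim_id // xk scale0r addr0 ev_chi.
have ev0 : ev 0 = 0 by have := evZD (-1) 0 0; rewrite scaleN1r addNr mulN1r addNr.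
exists (nat -> V), (coind_act k r), (fun f => ev (f 0%N)); split.
- exact: coind_rep.
- by move=> a u v; exact: evZD.
- exact: evr.
- by exists (fun=> v1).
move=> lt_kN; case: (ltnP k.+1 N) => [lt_k1N|ge_k1N].
  (* A constant sequence carries the old vector along: at place 0, ['X^(N.-1)] acts through [r]
     alone. *)
  have [v v0 v_next] := ev_next lt_k1N; exists (fun=> v) => //.
  have Xk : ('X^(N.-1) : {poly K})`_k = 0 by rewrite coefXn; case: eqP => //; lia.
  by rewrite /coind_act /= trim_id // Xk scale0r addr0.
have Nk : N.-1 = k by lia.
(* Here ['X^(N.-1)] is the newly added generator, which acts as the shift and moves [v1] to place
   0. *)
exists (fun i => if i is 0 then 0 else v1) => //.
rewrite /coind_act /= Nk /trim coefXn eqxx !scale1r subrr.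
case: rP => rZD rr _; rewrite (_ : r 0 0 = 0) ?add0r //.
by have := rr 0 (-1) 0 0; rewrite !scaleN1r !addNr.
Qed.

End Character.

(** * The dual module *)

Section Dual.
Variables (K : fieldType) (V : lmodType K) (r : {poly K} -> V -> V).
Hypothesis rP : is_rep 0 r.

(** The bracket relation of the contragredient action, evaluated at [v]; [fX] encodes the convention
    U_(-2) = 0. *)
Lemma functional_bracket (f : V -> K^o) (n m : int) v :
  is_lin f -> -1 <= n -> -1 <= m ->
  let fX (k : int) := if -1 <= k then - f (r 'X^(absz (k + 1)) v) else 0 in
  - - f (r 'X^(absz (m + 1)) (r 'X^(absz (n + 1)) v))
    - - - f (r 'X^(absz (n + 1)) (r 'X^(absz (m + 1)) v))
  = (n - m)%:~R *: (fX (n + m + 2) - 4 *: fX (n + m)).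
Proof.
case: rP => rZD rr rb fP le1n le1m.
have vX i : vanish 0 ('X^i : {poly K}) by apply/vanishP.
have rl u : is_lin (r^~ u) by move=> a p q; exact: rZD.
set i := (absz (n + 1)); set j := (absz (m + 1)) => /=.
have nm : (n - m)%:~R = i%:R - j%:R :> K.
  by rewrite !pmulrn -intrB; congr _%:~R; rewrite /i /j; lia.
have -> : -1 <= n + m + 2 by lia.
rewrite nm (_ : (absz (n + m + 2 + 1)) = (i + j).+1); last by rewrite /i /j; lia.
rewrite !opprK -[LHS]opprK opprB -(is_linB fP) rb // brXn.
rewrite (is_linZ (rl v)) (is_linB (rl v)) (is_linZ (rl v)).
rewrite (is_linZ fP) (is_linB fP) (is_linZ fP).
case: ifP => le1; last first.
  have [-> ->] : i = 0%N /\ j = 0%N by rewrite /i /j; lia.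
  by lin K.
rewrite (_ : (absz (n + m + 1)) = (i + j).-1); last by rewrite /i /j; lia.
rewrite -[LHS]scalerN opprB; congr (_ *: _).
by rewrite [in RHS]scalerN opprK addrC.
Qed.

Lemma is_lin_fctZD b (f g : V -> K^o) :
  is_lin f -> is_lin g -> is_lin (b *: f + g).
Proof. by move=> fZD gZD a u v; rewrite !fctE fZD gZD; lin K. Qed.

Lemma is_lin_fct0 : is_lin (0 : V -> K^o).
Proof. by move=> a u v; rewrite scaler0 addr0. Qed.

Definition dual := sub_of (Subsp is_lin_fct0 is_lin_fctZD).

Lemma dual_lin (g : dual) : is_lin (val g).
Proof. by case: g => f f_in; exact: (elimT (subsp_predP _ _) f_in). Qed.

Lemma dual_act_subproof p (g : dual) : is_lin (fun v => - val g (r p v)).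
Proof. by case: rP => _ rr _ a u v; rewrite rr dual_lin; lin K. Qed.

Definition mk_dual f (fP : is_lin f) : dual :=
  SubOf (introT (subsp_predP (Subsp is_lin_fct0 is_lin_fctZD) f) fP).

Definition dual_act (k : int) (g : dual) : dual :=
  mk_dual (dual_act_subproof 'X^(absz (k + 1)) g).

Lemma dualP (g h : dual) : val g =1 val h -> g = h.
Proof. by move=> gh; apply/val_inj/funext. Qed.

Lemma dual_Omodule : is_Omodule dual_act.
Proof.
split=> [k a g h|n m le1n le1m g]; apply: dualP => v.
  rewrite /=; set u := r _ v.
  by change (- (a *: val g u + val h u) = a *: - val g u - val h u); lin K.
apply: etrans (functional_bracket v (dual_lin g) le1n le1m) _.
by rewrite /actU; do 2!case: ifP => _.
Qed.
End Dual.

(** The vector w is the functional [ev] itself, and [c i] is the value of the character on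
    U_(i-1). *)
Lemma whittaker_module (K : fieldType) (N : nat) (c : nat -> K) :
  (forall i j, (N <= i)%N -> (N <= j)%N ->
    (i%:R - j%:R) * (c (i + j).+1 - 4 * c (i + j).-1) = 0) ->
  exists (W : lmodType K) (sigma : int -> W -> W) (w : W),
  [/\ is_Omodule sigma, (forall i, (N <= i)%N -> sigma (i%:Z - 1) w = c i *: w),
      w != 0 & (0 < N)%N -> forall a, sigma (N%:Z - 2) w <> a *: w].
Proof.
move=> cP; have [V [r [ev [rP evP ev_chi [v1 ev1] ev_next]]]] :=
  coinduced_functional cP (leq0n N).
exists (dual V), (dual_act rP), (mk_dual (evP : is_lin (ev : V -> K^o))).
split.
- exact: dual_Omodule.
- move=> i le_Ni; apply: dualP => v.
  change (- ev (r 'X^(absz (i%:Z - 1 + 1)) v) = c i * ev v).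
  rewrite subrK ev_chi ?chiXn ?mulNr ?opprK //.
  by apply/vanishP => j lt_jN; rewrite coefXn ltn_eqF // (leq_trans lt_jN).
- apply/eqP => /(congr1 (fun g => val g v1)) w0.
  have := ev1; rewrite -[ev v1]/(val (mk_dual (evP : is_lin (ev : V -> K^o))) v1) w0.
  by move/eqP; rewrite eq_sym oner_eq0.
move=> N_gt0 a /(congr1 val); have [v v0 v1'] := ev_next N_gt0.
move/(congr1 (fun f => f v)); rewrite -[RHS]/(a * ev v) v0 mulr0.
rewrite -[LHS]/(- ev (r 'X^(absz (N%:Z - 2 + 1)) v)).
rewrite (_ : absz _ = N.-1) ?v1'; last by lia.
by move/eqP; rewrite oppr_eq0 oner_eq0.
Qed.

(** * Reducible case *)

(** The Lie condition for a = k - n and b = n, which are distinct because k > 2n. *)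
Lemma phi_rec (K : fieldType) (n : nat) (phi : nat -> K) k :
  [pchar K] =i pred0 -> is_Lie_hom_Fn n phi -> (2 * n < k)%N ->
  phi k.+2 = 4 * phi k.
Proof.
move=> /pcharf0P K0 phiP lt_nk; have le_nk : (n <= k - n)%N by lia.
have := phiP _ _ le_nk (leqnn n); rewrite addn2 subnK; last by lia.
have -> : (k - n)%:R - n%:R = (k - n - n)%:R :> K by rewrite [RHS]natrB.
move/eqP; rewrite mulf_eq0 K0 subr_eq0; case/orP => [|/eqP //].
by rewrite subn_eq0; lia.
Qed.

Lemma reducible (K : fieldType) (n : nat) (phi c : nat -> K) (M : lmodType K)
  (rho : int -> M -> M) (w : M) :
  is_universal_Whittaker n phi rho w ->
  (forall i j, (n <= i)%N -> (n <= j)%N ->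
    (i%:R - j%:R) * (c (i + j).+1 - 4 * c (i + j).-1) = 0) ->
  (forall k, (n <= k)%N -> c k.+1 = phi k) ->
  ~ Oirreducible rho.
Proof.
move=> [rhoP [_ univ]] cP c_phi [_ irr].
have whit N (W : lmodType K) (sigma : int -> W -> W) v : (N <= n.+1)%N ->
    (forall i, (N <= i)%N -> sigma (i%:Z - 1) v = c i *: v) ->
    is_Whittaker_vec n phi sigma v.
  move=> le_Nn sv k le_nk; rewrite -c_phi // -sv ?(leq_trans le_Nn) //.
  by congr sigma; lia.
(* [W1] realizes the extended character on F_(n-1); in [W2] only phi on F_n is prescribed, and
   U_(n-1) [w2] is not a multiple of [w2]. *)
have [W1 [s1 [w1 [s1P s1w w1_neq0 _]]]] := whittaker_module cP.
have [|W2 [s2 [w2 [s2P s2w _ s2_neq]]]] := @whittaker_module K n.+1 c.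
  by move=> i j /ltnW le_ni /ltnW le_nj; apply: cP.
have [f [[fP fr] fw _]] := univ _ _ _ s1P (whit n _ _ _ (leqnSn n) s1w).
have [g [[gP gr] gw _]] := univ _ _ _ s2P (whit n.+1 _ _ _ (leqnn _) s2w).
have s1_lin k : is_lin (s1 k) by case: s1P => H _; exact: H.
(* The kernel of f contains U_(n-1) w - [c n] w, which g shows to be nonzero; it is proper since f w
   = [w1]. *)
case: (irr (fun x => f x = 0)) => [|ker0|all0].
- split; first exact: is_lin0 fP.
  split=> [u v u0 v0|]; first by rewrite (is_linD fP) u0 v0 addr0.
  split=> [a u u0|k u le1k u0]; first by rewrite (is_linZ fP) u0 scaler0.
  by rewrite fr // u0 (is_lin0 (s1_lin k)).
- have le1 : (-1 : int) <= n%:Z - 1 by lia.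
  have /ker0 : f (rho (n%:Z - 1) w - c n *: w) = 0.
    by rewrite (is_linB fP) (is_linZ fP) fr // fw s1w // subrr.
  move/(congr1 g); rewrite (is_linB gP) (is_linZ gP) gr // gw (is_lin0 gP).
  move/subr0_eq; rewrite (_ : n%:Z - 1 = n.+1%:Z - 2); last by lia.
  exact: s2_neq.
by move: w1_neq0; rewrite -fw all0 eqxx.
Qed.

Lemma reducible_extension (K : fieldType) (n : nat) (phi : nat -> K)
  (M : lmodType K) (rho : int -> M -> M) (w : M) :
  [pchar K] =i pred0 -> is_Lie_hom_Fn n phi ->
  is_universal_Whittaker n phi rho w ->
  phi (2 * n).+2 = 4 * phi (2 * n)%N ->
  ((0 < n)%N -> phi (2 * n).+1 = 4 * phi (2 * n).-1) ->
  ~ Oirreducible rho.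
Proof.
move=> K0 phiP univ phi_even phi_odd.
(* [c n] is the value on U_(n-1). For n >= 1 any value would do; for n = 0 the bracket of U_0 and
   U_(-1) forces phi(U_1) = 4 phi(U_(-1)). *)
pose c i := if i == n then phi 1%N / 4 else phi i.-1.
have c_phi k : (n <= k)%N -> c k.+1 = phi k by rewrite /c; case: eqP => //; lia.
apply: (reducible univ (c := c)) => // i j le_ni le_nj.
have [-> | neq_ij] := eqVneq i j; first by rewrite subrr mul0r.
rewrite c_phi; last by lia.
have n4 : 4 != 0 :> K by rewrite ((pcharf0P K).1 K0).
case: (ltnP (i + j) (2 * n + 3)) => [small|big]; last first.
  rewrite (_ : (i + j).-1 = (i + j - 2).+1) ?c_phi; try by lia.
  rewrite -(phi_rec K0 phiP); last by lia.
  by rewrite (_ : (i + j - 2).+2 = i + j)%N ?subrr ?mulr0 //; lia.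
have [ij|ij] : (i + j = (2 * n).+1 \/ i + j = (2 * n).+2)%N by lia.
  rewrite ij /=; case: (posnP n) => [n0|n_gt0].
    by rewrite /c n0 /= [4 * _]mulrC divfK // subrr mulr0.
  rewrite (_ : (2 * n)%N = (2 * n).-1.+1) ?c_phi; try by lia.
  by rewrite prednK ?phi_odd ?subrr ?mulr0 //; lia.
by rewrite ij /= c_phi ?phi_even ?subrr ?mulr0 //; lia.
Qed.

(** * Irreducible case *)

Section Filtration.
Variables (K : fieldType) (M : lmodType K) (e : M -> M) (V : M -> Prop).
Hypotheses (e_lin : is_lin e) (V0 : V 0).
Hypothesis VZD : forall a u v, V u -> V v -> V (a *: u + v).

(** The sum of the e^i V over i < j, so that [fil j (x - iter j e v)] says that x has leading term
    e^j v. *)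
Fixpoint fil j x : Prop :=
  if j is i.+1 then exists2 v, V v & fil i (x - iter i e v) else x = 0.

Lemma iter_lin j : is_lin (iter j e).
Proof. by elim: j => [|j IH] a u v //=; rewrite IH e_lin. Qed.

Lemma iterZ j a v : iter j e (a *: v) = a *: iter j e v.
Proof. exact: is_linZ (iter_lin j) _ _. Qed.

Lemma iter0 j : iter j e 0 = 0.
Proof. exact: is_lin0 (iter_lin j). Qed.

Lemma VZ a v : V v -> V (a *: v).
Proof. by move=> Vv; rewrite -[_ *: _]addr0; apply: VZD. Qed.

Lemma filZD j a x y : fil j x -> fil j y -> fil j (a *: x + y).
Proof.
elim: j x y => [|j IH] x y /= => [-> ->|[u Vu xu] [v Vv yv]].
  by rewrite scaler0 addr0.
exists (a *: u + v); first exact: VZD.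
rewrite iter_lin (_ : _ - _ = a *: (x - iter j e u) + (y - iter j e v)); first exact: IH.
by lin K.
Qed.

Lemma fil0 j : fil j 0.
Proof. by elim: j => //= j IH; exists 0; rewrite // iter0 subr0. Qed.

Lemma filZ j a x : fil j x -> fil j (a *: x).
Proof. by move=> fx; rewrite -[_ *: _]addr0; apply: filZD => //; apply: fil0. Qed.

Lemma filD j x y : fil j x -> fil j y -> fil j (x + y).
Proof. by rewrite -{2}[x]scale1r; apply: filZD. Qed.

Lemma filB j x y : fil j x -> fil j y -> fil j (x - y).
Proof. by move=> fx fy; rewrite addrC -scaleN1r; apply: filZD. Qed.

Lemma filS j x : fil j x -> fil j.+1 x.
Proof. by move=> fx; exists 0; rewrite // iter0 subr0. Qed.

Lemma filW i j x : (i <= j)%N -> fil i x -> fil j x.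
Proof.
move=> /subnK <-; elim: (j - i)%N => // d IH /IH; rewrite addSn; exact: filS.
Qed.

Lemma fil_iter j v : V v -> fil j.+1 (iter j e v).
Proof. by move=> Vv; exists v; rewrite // subrr; apply: fil0. Qed.

Lemma fil_e j x : fil j x -> fil j.+1 (e x).
Proof.
elim: j x => [|j IH] x; first by move=> ->; rewrite (is_lin0 e_lin); apply: fil0.
by case=> v Vv /IH; rewrite (is_linB e_lin) => ?; exists v.
Qed.

Lemma fil_map (g : nat -> nat) (T : M -> M) :
  is_lin T -> {homo g : i j / (i <= j)%N} ->
  (forall j v, V v -> fil (g j) (T (iter j e v))) ->
  forall j x, fil j.+1 x -> fil (g j) (T x).
Proof.
move=> T_lin g_homo Tg; elim=> [|j IH] x [v Vv].
  by move/subr0_eq=> ->; apply: Tg.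
move/IH; rewrite (is_linB T_lin) => Txv.
rewrite -[T x](subrK (T (iter j.+1 e v))).
by apply: filD (Tg _ _ Vv); apply: filW Txv; apply: g_homo.
Qed.

Lemma fil_top j x : fil j x -> x != 0 ->
  exists i v, [/\ V v, v != 0 & fil i (x - iter i e v)].
Proof.
elim: j x => [|j IH] x; first by move=> ->; rewrite eqxx.
case=> v Vv; have [-> | v_neq0 xv _] := eqVneq v 0; last by exists j, v.
by rewrite iter0 subr0; apply: IH.
Qed.

(** Operators preserving S lower the leading exponent, by one or more, and keep the leading
    coefficient nonzero. At exponent 0 the element lies in V itself, as [fil 0] is zero. *)
Lemma fil_descent (S : M -> Prop) :
  (forall j v, V v -> v != 0 -> exists T i v', [/\ (forall x, S x -> S (T x)),
      (i <= j)%N, V v', v' != 0 &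
      forall x, fil j.+1 (x - iter j.+1 e v) -> fil i (T x - iter i e v')]) ->
  forall j x v, S x -> V v -> v != 0 -> fil j (x - iter j e v) ->
  exists v0, [/\ V v0, v0 != 0 & S v0].
Proof.
move=> lower j; elim/ltn_ind: j => -[_ | j IH] x v Sx Vv v_neq0 xv.
  by exists v; move: Sx; rewrite (subr0_eq xv).
have [T [i [v' [TS le_ij Vv' v'_neq0 Tv']]]] := lower j v Vv v_neq0.
exact: IH (TS _ Sx) Vv' v'_neq0 (Tv' _ xv).
Qed.

End Filtration.
Arguments fil : simpl never.

(** * The subspaces U(F_k) w and leading terms *)

Section Modules.
Variables (K : fieldType) (M : lmodType K) (rho : int -> M -> M) (w : M).
Hypothesis rhoP : is_Omodule rho.

(* Indices are shifted by one to make them natural numbers: [U i] is the action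
   of the generator U_(i-1), and [i >= n.+1] means U_(i-1) in F_n. *)
Definition U (i : nat) : M -> M := rho (i%:Z - 1).
Definition Vop (i : nat) (v : M) : M := U i.+2 v - 4 *: U i v.

Lemma U_lin i : is_lin (U i).
Proof. by case: rhoP => H _; exact: H. Qed.

Lemma Vop_lin i : is_lin (Vop i).
Proof. by move=> a u v; rewrite /Vop !U_lin; lin K. Qed.

Lemma U_comm i j v :
  U i (U j v) = U j (U i v) + (i%:R - j%:R) *: Vop (i + j).-1 v.
Proof.
case: rhoP => _ comm; have le1 k : (-1 : int) <= k%:Z - 1 by lia.
apply/eqP; rewrite addrC -subr_eq comm //; apply/eqP.
have -> : (i%:Z - 1 - (j%:Z - 1))%:~R = i%:R - j%:R :> K.
  by rewrite !pmulrn -intrB; congr _%:~R; lia.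
case: (posnP (i + j)%N) => [|ij].
  by move=> /eqP; rewrite addn_eq0 => /andP[/eqP-> /eqP->]; rewrite subrr !scale0r.
rewrite /actU !ifT; try by lia.
by rewrite /Vop /U; congr (_ *: (rho _ _ - 4 *: rho _ _)); lia.
Qed.

(** The subspace U(F_(k-1)) w, as an intersection of stable subspaces; this avoids the enveloping
    algebra and gives induction by application. *)
Definition gen (k : nat) (x : M) : Prop :=
  forall S : M -> Prop, S w -> (forall a u v, S u -> S v -> S (a *: u + v)) ->
  (forall i u, (k <= i)%N -> S u -> S (U i u)) -> S x.

Lemma gen_w k : gen k w.
Proof. by []. Qed.

Lemma genZD k a u v : gen k u -> gen k v -> gen k (a *: u + v).
Proof. by move=> gu gv S Sw SZD SU; apply: (SZD); [apply: gu | apply: gv]. Qed.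

Lemma gen_U k i u : (k <= i)%N -> gen k u -> gen k (U i u).
Proof. by move=> le_ki gu S Sw SZD SU; apply: (SU) => //; apply: gu. Qed.

Lemma gen0 k : gen k 0.
Proof. by rewrite -[0](addNr w) -scaleN1r; apply: genZD; apply: gen_w. Qed.

Lemma genW k l u : (l <= k)%N -> gen k u -> gen l u.
Proof.
move=> le_lk gu S Sw SZD SU; apply: gu => // i v le_ki; apply: SU.
exact: leq_trans le_ki.
Qed.

Lemma gen_Vop k i u : (k <= i)%N -> gen k u -> gen k (Vop i u).
Proof.
move=> le_ki gu; rewrite /Vop addrC -scaleNr.
by apply: genZD; apply: gen_U => //; apply: leq_trans le_ki _; lia.
Qed.

Section Stage.
Variable k : nat.
Let e := U k.
Let V := gen k.+1.
Local Notation filk := (fil e V).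

Let e_lin : is_lin e := U_lin k.
Let V0 : V 0 := @gen0 k.+1.
Let VZD := @genZD k.+1.

Lemma Ue i x : U i (e x) = e (U i x) + (i%:R - k%:R) *: Vop (i + k).-1 x.
Proof. exact: U_comm. Qed.

Lemma U_iter_fil i j v : (k < i)%N -> V v -> filk j.+1 (U i (iter j e v)).
Proof.
elim: j i v => [|j IH] i v lt_ki Vv.
  by apply: fil_iter => //; apply: gen_U.
rewrite /= Ue; apply: filD => //; first by apply: fil_e => //; apply: IH.
apply: filZ => //; rewrite /Vop; apply: filB => //.
  by apply: filS => //; apply: IH => //; lia.
(* For i = 1, hence k = 0, the bracket with e involves e itself, and e^(j+1) v still respects the
   bound. *)
apply: filZ => //; have [->|i_neq1] := eqVneq i 1%N; last first.
  by apply: filS => //; apply: IH => //; lia.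
by rewrite [(1 + k).-1]/= -[U k _]/(iter j.+1 e v); apply: fil_iter.
Qed.

Lemma U_fil i j x : (k < i)%N -> filk j x -> filk j (U i x).
Proof.
case: j => [|j] lt_ki; first by move=> ->; rewrite (is_lin0 (U_lin i)).
apply: (fil_map e_lin V0 VZD (g := S) (U_lin i)) => [m n|m v Vv] //.
exact: U_iter_fil.
Qed.

Lemma gen_fil x : gen k x -> exists j, filk j x.
Proof.
move=> /(_ (fun y => exists j, filk j y)).
apply=> [|a u v [i ui] [j vj]|i u le_ki [j uj]].
- by exists 1%N; apply: (fil_iter e_lin V0 0); apply: gen_w.
- exists (maxn i j); apply: filZD => //.
    by apply: filW ui => //; apply: leq_maxl.
  by apply: filW vj => //; apply: leq_maxr.
move: le_ki; rewrite leq_eqVlt => /predU1P[<-|lt_ki].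
  by exists j.+1; apply: fil_e.
by exists j; apply: U_fil.
Qed.

(** For i > 1 the bracket of [U i] and e involves only indices above k, whose operators do not raise
    the exponent. *)
Lemma U_iter_top i j v : (1 < i)%N -> (k < i)%N -> V v ->
  filk j (U i (iter j e v) - iter j e (U i v)).
Proof.
move=> lt_1i lt_ki Vv; elim: j => [|j IH]; first by rewrite subrr.
rewrite /= Ue addrAC -(is_linB e_lin).
apply: filD => //; first exact: fil_e.
apply: filZ => //; apply: filB => //; last apply: filZ => //.
  by apply: U_iter_fil => //; lia.
by apply: U_iter_fil => //; lia.
Qed.

Lemma Vop_iter_top c j v : (1 < c)%N -> (k < c)%N -> V v ->
  filk j (Vop c (iter j e v) - iter j e (Vop c v)).
Proof.
move=> lt_1c lt_kc Vv; rewrite /Vop (is_linB (iter_lin e_lin j)) iterZ //.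
set a := U _ _; set b := U _ _; set a' := iter _ _ _; set b' := iter _ _ _.
rewrite (_ : _ - _ = (a - a') - 4 *: (b - b')); last by lin K.
apply: filB => //; last apply: filZ => //.
  by apply: U_iter_top => //; lia.
exact: U_iter_top.
Qed.

Lemma Vop_top c j x v : (1 < c)%N -> (k < c)%N -> V v ->
  filk j (x - iter j e v) -> filk j (Vop c x - iter j e (Vop c v)).
Proof.
move=> lt_1c lt_kc Vv xv; rewrite -(subrK (Vop c (iter j e v)) (Vop c x)) -addrA.
apply: filD => //; last exact: Vop_iter_top.
rewrite -(is_linB (Vop_lin c)) /Vop; apply: filB => //; last apply: filZ => //.
  by apply: U_fil xv; lia.
exact: U_fil.
Qed.

Section Lowering.
Variables (c d : nat) (a : K).
Hypotheses (lt_1c : (1 < c)%N) (lt_kc : (k < c)%N) (dk : (d + k = c.+1)%N).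
Hypothesis Ud : forall v, V v -> U d v = a *: v.

Let T x := U d x - a *: x.

Lemma T_lin : is_lin T.
Proof. by move=> b u v; rewrite /T U_lin; lin K. Qed.

(** As d + k = c + 1, the bracket of [T] and e is (d - k) [Vop c], and [T] kills V: each of the j +
    1 factors e contributes the same leading term. *)
Lemma T_iter_top j v : V v ->
  filk j (T (iter j.+1 e v) - (j.+1%:R * (d%:R - k%:R)) *: iter j e (Vop c v)).
Proof.
have Te x : T (e x) = e (T x) + (d%:R - k%:R) *: Vop c x.
  rewrite /T Ue dk (is_linB e_lin) (is_linZ e_lin).
  by rewrite -[c.+1.-1]/c; lin K.
move=> Vv; elim: j => [|j IH].
  rewrite /= Te {1}/T Ud // subrr (is_lin0 e_lin).
  by rewrite mul1r add0r subrr.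
rewrite [iter j.+2 e v]/= Te -/(iter j.+1 e v).
move/(fil_e e_lin V0): IH; rewrite (is_linB e_lin) (is_linZ e_lin) => IH.
have IH2 := filZ e_lin V0 VZD (d%:R - k%:R) (Vop_iter_top j.+1 lt_1c lt_kc Vv).
have := filD e_lin VZD IH IH2; congr (fil e V _ _).
by rewrite -[in RHS]natr1 /=; set x := T _; lin K.
Qed.

Lemma T_lower j x v : V v -> filk j.+1 (x - iter j.+1 e v) ->
  filk j (T x - iter j e ((j.+1%:R * (d%:R - k%:R)) *: Vop c v)).
Proof.
move=> Vv xv; rewrite iterZ // -(subrK (T (iter j.+1 e v)) (T x)) -addrA.
apply: filD => //; last exact: T_iter_top.
rewrite -(is_linB T_lin).
apply: (fil_map e_lin V0 VZD (g := id) T_lin) xv => // -[|i] u Vu.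
  by rewrite /= /T Ud // subrr.
rewrite -(subrK ((i.+1%:R * (d%:R - k%:R)) *: iter i e (Vop c u)) (T _)).
apply: filD => //; first by apply: filS => //; apply: T_iter_top.
by apply: filZ => //; apply: fil_iter => //; apply: gen_Vop.
Qed.

End Lowering.
End Stage.

End Modules.

(** * Whittaker vectors and the case n >= 1 *)

Section WhittakerVector.
Variables (K : fieldType) (n : nat) (phi : nat -> K).
Variables (M : lmodType K) (rho : int -> M -> M) (w : M).
Hypotheses (K0 : [pchar K] =i pred0) (phiP : is_Lie_hom_Fn n phi).
Hypotheses (rhoP : is_Omodule rho) (wP : is_Whittaker_vec n phi rho w).
Local Notation U := (U rho).
Local Notation Vop := (Vop rho).
Local Notation gen := (gen rho w).

Lemma natr_neq0 k : (0 < k)%N -> k%:R != 0 :> K.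
Proof. by rewrite ((pcharf0P K).1 K0) lt0n. Qed.

Lemma U_w i : (n < i)%N -> U i w = phi i.-1 *: w.
Proof. by case: i => // i le_ni; rewrite -wP // /U; congr rho; lia. Qed.

Lemma Vop_w i : (n < i)%N -> Vop i w = (phi i.+1 - 4 * phi i.-1) *: w.
Proof. by move=> lt_ni; rewrite /Vop !U_w //; [lin K | lia]. Qed.

Lemma gen_line x : gen n.+1 x -> exists b, x = b *: w.
Proof.
move=> /(_ (fun y => exists b, y = b *: w)); apply.
- by exists 1; rewrite scale1r.
- by move=> a _ _ [b ->] [b' ->]; exists (a * b + b'); lin K.
move=> i _ lt_ni [b ->]; exists (b * phi i.-1).
by rewrite (is_linZ (U_lin rhoP i)) U_w // scalerA.
Qed.

Lemma submodule_ZD (S : M -> Prop) a u v :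
  is_submodule rho S -> S u -> S v -> S (a *: u + v).
Proof. by case=> _ [SD [SZ _]] Su Sv; apply: SD => //; apply: SZ. Qed.

Lemma submodule_U (S : M -> Prop) i v : is_submodule rho S -> S v -> S (U i v).
Proof. by case=> _ [_ [_ SU]] Sv; apply: SU => //; lia. Qed.

Lemma zero_submodule : is_submodule rho (fun x => x = 0).
Proof.
split=> //; split=> [u v -> ->|]; first exact: addr0.
split=> [a u ->|k u _ ->]; first exact: scaler0.
by case: rhoP => lin _; exact: (is_lin0 (lin k)).
Qed.

Section TopIndex.
Hypothesis w_neq0 : w != 0.
Variable c : nat.
Hypotheses (n_gt0 : (0 < n)%N) (le_nc : (2 * n <= c)%N) (le_cn : (c <= (2 * n).+1)%N).
Hypothesis phi_c : phi c.+1 != 4 * phi c.-1.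
Hypothesis phi_gtc : forall j, (c < j)%N -> phi j.+1 = 4 * phi j.-1.

(** Since [Vop c] is V_(c-1), [c] is one more than the top index of the opening outline. Moving
    [Vop j] past [U i] with i >= 1 creates only [Vop] of index at least j. *)
Lemma Vop_gen1 v j : gen 1 v -> (c < j)%N -> Vop j v = 0.
Proof.
move=> gv; move: v gv j => v /(_ (fun v => forall j, (c < j)%N -> Vop j v = 0)).
apply=> [j lt_cj|a u u' u0 u'0 j lt_cj|i u le1i u0 j lt_cj].
- by rewrite Vop_w; [rewrite phi_gtc // subrr scale0r | lia].
- by rewrite (Vop_lin rhoP) u0 // u'0 // scaler0 addr0.
rewrite {1}/Vop !(U_comm rhoP _ i) !(u0 (_ + _).-1); try by lia.
rewrite !scaler0 !addr0 -(is_linZ (U_lin rhoP i)) -(is_linB (U_lin rhoP i)).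
by rewrite -/(Vop j u) u0 // (is_lin0 (U_lin rhoP i)).
Qed.

(** For i > k the bracket with [U i] is a multiple of [Vop (c - k + i)], whose index exceeds c. *)
Lemma U_scalar k v : (k <= n)%N -> gen k.+1 v ->
  U (c.+1 - k) v = phi (c.+1 - k).-1 *: v.
Proof.
move=> le_kn gv; have g1 : gen 1 v by apply: genW gv.
set d := (c.+1 - k)%N.
suff [] : gen k.+1 v /\ U d v = phi d.-1 *: v by [].
move: gv => /(_ (fun v => gen k.+1 v /\ U d v = phi d.-1 *: v)).
apply=> [|a u u' [gu Uu] [gu' Uu']|i u lt_ki [gu Uu]].
- by split; [exact: gen_w | apply: U_w; rewrite /d; lia].
- by split; [exact: genZD | rewrite (U_lin rhoP) Uu Uu'; lin K].
split; first exact: gen_U.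
rewrite (U_comm rhoP) Uu (is_linZ (U_lin rhoP i)) Vop_gen1 ?scaler0 ?addr0 //.
  exact: genW gu.
by rewrite /d; lia.
Qed.

(** The second conclusion is carried along because it makes the leading coefficient nonzero at the
    next stage. *)
Lemma gen_irreducible k x : (k <= n.+1)%N -> gen k x -> x != 0 ->
  (forall S, is_submodule rho S -> S x -> S w) /\ Vop c x != 0.
Proof.
move=> le_kn; rewrite -(subKn le_kn).
elim: (n.+1 - k)%N (leq_subr k n.+1) x => [_ x|m IH lt_mn x].
  rewrite subn0 => /gen_line [b ->] bw_neq0.
  have b_neq0 : b != 0 by apply: contraNneq bw_neq0 => ->; rewrite scale0r.
  split=> [S [_ [_ [SZ _]]] /(SZ b^-1)|].
    by rewrite scalerA mulVf // scale1r.
  rewrite (is_linZ (Vop_lin rhoP c)) Vop_w; last by lia.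
  by rewrite !scaler_eq0 !negb_or b_neq0 subr_eq0 phi_c.
set l := (n.+1 - m.+1)%N; have ml : (n.+1 - m = l.+1)%N by rewrite /l; lia.
rewrite ml in IH; have {}IH := IH (ltnW lt_mn).
have le_ln : (l <= n)%N by rewrite /l; lia.
have [lt_1c lt_lc dl] : [/\ (1 < c)%N, (l < c)%N & (c.+1 - l + l = c.+1)%N] by split; lia.
have e_lin := U_lin rhoP l.
have descent S j y v : is_submodule rho S -> S y -> gen l.+1 v -> v != 0 ->
    fil (U l) (gen l.+1) j (y - iter j (U l) v) -> S w.
  move=> SP Sy gv v_neq0 yv.
  case: (fil_descent (S := S) _ Sy gv v_neq0 yv); last first.
    by move=> v0 [gv0 v0_neq0 Sv0]; case: (IH _ gv0 v0_neq0) => /(_ S SP Sv0).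
  move=> {y Sy v gv v_neq0 yv}i v gv v_neq0.
  exists (fun y => U (c.+1 - l) y - phi (c.+1 - l).-1 *: y), i.
  exists ((i.+1%:R * ((c.+1 - l)%:R - l%:R)) *: Vop c v); split=> //.
  - move=> y Sy; rewrite addrC -scaleNr; apply: submodule_ZD => //.
    exact: submodule_U.
  - by apply: VZ (gen_Vop _ gv) => //; [exact: gen0 | exact: genZD].
  (* The factor c + 1 - 2l is positive since l <= n and 2n <= c. *)
  - rewrite scaler_eq0 negb_or; have [_ ->] := IH _ gv v_neq0.
    by rewrite andbT -natrB ?mulf_neq0 ?natr_neq0 //; lia.
  by move=> y; apply: T_lower => // u; apply: U_scalar.
move=> gx x_neq0; have [j xj] := gen_fil rhoP gx.
have [i [v [gv v_neq0 xv]]] := fil_top e_lin xj x_neq0.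
split=> [S SP Sx|]; first exact: descent xv.
(* [Vop c] keeps the leading exponent, so if [Vop c x] were zero, descent inside the zero submodule
   would give w = 0. *)
apply/eqP => Vx0; have [_ Vv_neq0] := IH _ gv v_neq0.
have := Vop_top rhoP lt_1c lt_lc gv xv.
move/(descent _ _ _ _ zero_submodule Vx0 (gen_Vop lt_lc gv) Vv_neq0) => w0.
by move: w_neq0; rewrite w0 eqxx.
Qed.

End TopIndex.

End WhittakerVector.

(** * The case n = 0 *)

Section RankOne.
Variables (K : fieldType) (phi : nat -> K).
Variables (M : lmodType K) (rho : int -> M -> M) (w : M).
Hypotheses (K0 : [pchar K] =i pred0) (phiP : is_Lie_hom_Fn 0 phi).
Hypotheses (rhoP : is_Omodule rho) (wP : is_Whittaker_vec 0 phi rho w).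
Local Notation U := (U rho).
Local Notation Vop := (Vop rho).
Let e := U 0.
Let V := gen rho w 1.
Local Notation filr := (fil e V).
Let e_lin : is_lin e := U_lin rhoP 0.
Let V0 : V 0 := @gen0 _ _ _ _ 1.
Let VZD := @genZD _ _ rho w 1.
Let T i x := U i x - phi i.-1 *: x.
Let f := phi 2 - 4 * phi 0.

Lemma T_is_lin i : is_lin (T i).
Proof. by move=> a u v; rewrite /T (U_lin rhoP); lin K. Qed.

Lemma T_e i x : T i (e x) = e (T i x) + i%:R *: Vop i.-1 x.
Proof.
rewrite /T (Ue rhoP) -/e addn0 subr0 (is_linB e_lin) (is_linZ e_lin); lin K.
Qed.

Lemma U_V i v : (0 < i)%N -> V v -> U i v = phi i.-1 *: v.
Proof.
move=> i_gt0 Vv; have [c ->] := gen_line rhoP wP Vv.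
by rewrite (is_linZ (U_lin rhoP i)) (U_w wP) // !scalerA mulrC.
Qed.

Lemma T_V i v : (0 < i)%N -> V v -> T i v = 0.
Proof. by move=> i_gt0 Vv; rewrite /T U_V // subrr. Qed.

Lemma T_iter i j v : (1 < i)%N -> V v -> filr j (T i (iter j e v)).
Proof.
move=> lt_1i Vv; have lt_0i := ltnW lt_1i.
have := U_iter_top rhoP j lt_1i lt_0i Vv.
by rewrite (U_V lt_0i Vv) iterZ.
Qed.

(** The bracket of [U 1] and e is [U 2] - 4 e, so each factor e lowers the eigenvalue by 4. *)
Lemma U1_iter j v : V v ->
  filr j (U 1 (iter j e v) - (phi 0 - 4 * j%:R) *: iter j e v).
Proof.
move=> Vv; elim: j => [|j IH]; first by rewrite /= U_V // mulr0 subr0 subrr.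
have U2 : filr j.+1 (U 2 (iter j e v)) by apply: U_iter_fil.
have := filD e_lin VZD (fil_e e_lin V0 IH) U2.
rewrite (is_linB e_lin) (is_linZ e_lin); congr (fil e V _ _).
by rewrite /= (Ue rhoP) addn0 /Vop -/e -(@natr1 _ j) /=; lin K.
Qed.

Lemma Vop1_iter j v : V v ->
  filr j (Vop 1 (iter j e v) - (f + 16 * j%:R) *: iter j e v).
Proof.
move=> Vv; have T3 := T_iter j (isT : (1 < 3)%N) Vv.
have := filB e_lin VZD T3 (filZ e_lin V0 VZD 4 (U1_iter j Vv)).
by congr (fil e V _ _); rewrite /T /Vop /f /=; lin K.
Qed.

(* Modulo lower powers of e, T 2 maps e^j w to a_j e^(j-1) w and T 3 maps it to
   b_j e^(j-2) w; for j >= 1 these two coefficients do not vanish together. *)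
Let a j : K := 2 * j%:R * f + 16 * j%:R * (j%:R - 1).
Let b j : K := - 12 * f * j%:R * (j%:R - 1) - 64 * j%:R * (j%:R - 1) * (j%:R - 2).

(** The bracket of [T 2] and e is 2 [Vop 1]; accordingly a_j is the sum of 2 (f + 16 i) over i <
    j. *)
Lemma T2_iter j v : V v -> filr j (T 2 (iter j.+1 e v) - a j.+1 *: iter j e v).
Proof.
move=> Vv; elim: j => [|j IH].
  have := filZ e_lin V0 VZD 2 (Vop1_iter 0 Vv); congr (fil e V _ _).
  by rewrite /= T_e T_V // (is_lin0 e_lin) /a /=; lin K.
have := filD e_lin VZD (fil_e e_lin V0 IH) (filZ e_lin V0 VZD 2 (Vop1_iter j.+1 Vv)).
rewrite (is_linB e_lin) (is_linZ e_lin); congr (fil e V _ _).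
rewrite [iter j.+2 e v]/= T_e -/(iter j.+1 e v).
by rewrite -[2.-1]/1%N /a -(@natr1 _ j.+1); set u := e (T _ _); lin K.
Qed.

Lemma Vop_V i v : (1 < i)%N -> V v -> Vop i v = 0.
Proof.
case: i => [|[|i]] // _ Vv; rewrite /Vop !U_V //= (phi_rec K0 phiP) //.
by lin K.
Qed.

Lemma T4_iter j v : V v -> filr j (T 4 (iter j.+1 e v)).
Proof.
move=> Vv; elim: j => [|j IH].
  by rewrite /= T_e T_V // Vop_V // (is_lin0 e_lin) scaler0 addr0.
rewrite [iter j.+2 e v]/= T_e; apply: filD => //; first exact: fil_e.
apply: filZ => //; have := @Vop_iter_top _ _ _ w rhoP 0 3 j.+1 v isT isT Vv.
by rewrite (@Vop_V 3 v) // -/e iter0 // subr0.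
Qed.

Lemma T3_e x : T 3 (e x) = e (T 3 x) + 3 *: (T 4 x - 4 *: T 2 x).
Proof.
by rewrite T_e; congr (_ + _ *: _); rewrite /T /Vop /= (phi_rec K0 phiP) //; lin K.
Qed.

(** By [T3_e], b_(j+1) = b_j - 12 a_j, the [T 4] term being of lower degree. *)
Lemma T3_iter j v : V v -> filr j (T 3 (iter j.+2 e v) - b j.+2 *: iter j e v).
Proof.
move=> Vv; elim: j => [|j IH].
  have := filB e_lin VZD (T4_iter 0 Vv) (filZ e_lin V0 VZD 4 (T2_iter 0 Vv)).
  move/(filZ e_lin V0 VZD 3); congr (fil e V _ _).
  have Tv i : (0 < i)%N -> T i v = 0 by move=> i_gt0; apply: T_V.
  rewrite /= T3_e T3_e !Tv // !scaler0 subr0 (is_lin0 e_lin) scaler0 addr0.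
  by rewrite (is_lin0 e_lin) /a /b; lin K.
have := filB e_lin VZD (T4_iter j.+1 Vv) (filZ e_lin V0 VZD 4 (T2_iter j.+1 Vv)).
move/(filZ e_lin V0 VZD 3)/(filD e_lin VZD (fil_e e_lin V0 IH)).
rewrite (is_linB e_lin) (is_linZ e_lin); congr (fil e V _ _).
rewrite [iter j.+3 e v]/= T3_e -/(iter j.+2 e v) -/(iter j.+1 e v).
by rewrite /a /b -(@natr1 _ j.+2); set u := e (T _ _); lin K.
Qed.

(** As a_j = 2 j (f + 8 (j - 1)), its vanishing for j >= 1 forces f = - 8 (j - 1), hence j >= 2, and
    then b_j = 32 (j - 1) j (j + 1). *)
Lemma a_or_b j : f != 0 -> (a j.+1 == 0) -> exists2 i, j = i.+1 & b j.+1 != 0.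
Proof.
move=> f_neq0; case: j => [|j].
  rewrite /a subrr mulr0 addr0 mulr1 mulf_eq0 (negPf f_neq0) orbF.
  by rewrite (negPf (natr_neq0 K0 _)).
move=> a0; exists j => //.
have fE : f = - 8 * j.+1%:R.
  have /eqP : (2 * j.+2%:R) * (f + 8 * j.+1%:R) = 0.
    by rewrite -(eqP a0) /a -[j.+2%:R]natr1; ring.
  rewrite mulf_eq0 mulf_eq0 !(negPf (natr_neq0 K0 _)) //= addr_eq0 => /eqP ->.
  by rewrite mulNr.
have -> : b j.+2 = 32 * j.+1%:R * j.+2%:R * j.+3%:R.
  by rewrite /b fE -[j.+3%:R]natr1 -[j.+2%:R]natr1; ring.
by rewrite !mulf_neq0 ?natr_neq0.
Qed.

Lemma gen_irreducible_rank1 x (S : M -> Prop) : f != 0 ->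
  gen rho w 0 x -> x != 0 -> is_submodule rho S -> S x -> S w.
Proof.
move=> f_neq0 gx x_neq0 SP Sx; have [j xj] := gen_fil rhoP gx.
have [i [v [gv v_neq0 xv]]] := fil_top e_lin xj x_neq0.
have ST k y : S y -> S (T k y).
  move=> Sy; rewrite /T addrC -scaleNr; apply: (submodule_ZD _ SP) => //.
  exact: submodule_U.
case: (fil_descent (S := S) _ Sx gv v_neq0 xv); last first.
  move=> v0 [Vv0 v0_neq0 Sv0]; move: v0_neq0 Sv0.
  have [c -> cw_neq0 Sv0] := gen_line rhoP wP Vv0.
  have c_neq0 : c != 0 by apply: contraNneq cw_neq0 => ->; rewrite scale0r.
  case: SP => _ [_ [SZ _]]; have := SZ c^-1 _ Sv0.
  by rewrite scalerA mulVf // scale1r.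
move=> {x x_neq0 Sx j gx xj i v gv v_neq0 xv} j v Vv v_neq0.
have [/(a_or_b f_neq0) [i -> b_neq0] | a_neq0] := boolP (a j.+1 == 0).
  exists (T 3), i, (b i.+2 *: v); split=> //; first exact: ST.
  - exact: (VZ V0 VZD (b i.+2) Vv).
  - by rewrite scaler_eq0 negb_or b_neq0.
  move=> x xv; rewrite iterZ // -(subrK (T 3 (iter i.+2 e v)) (T 3 x)) -addrA.
  apply: filD => //; last exact: T3_iter.
  rewrite -(is_linB (T_is_lin 3)).
  (* [T 3] lowers the exponent by two and kills both V and e V, whence the truncated predecessor. *)
  apply: (fil_map e_lin V0 VZD (g := predn) (T_is_lin 3)) xv => [m1 m2|[|[|m]] u Vu].
  - by lia.
  - by rewrite /= T_V.
  - have Tu k : (0 < k)%N -> T k u = 0 by move=> k_gt0; apply: T_V.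
    by rewrite /= T3_e !Tu // (is_lin0 e_lin) scaler0 subr0 scaler0 addr0.
  rewrite -(subrK (b m.+2 *: iter m e u) (T 3 _)).
  apply: filD => //; first by apply: filS => //; apply: T3_iter.
  by apply: filZ => //; apply: fil_iter.
exists (T 2), j, (a j.+1 *: v); split=> //; first exact: ST.
- exact: (VZ V0 VZD (a j.+1) Vv).
- by rewrite scaler_eq0 negb_or a_neq0.
move=> x xv; rewrite iterZ // -(subrK (T 2 (iter j.+1 e v)) (T 2 x)) -addrA.
apply: filD => //; last exact: T2_iter.
rewrite -(is_linB (T_is_lin 2)).
by apply: (fil_map e_lin V0 VZD (g := id) (T_is_lin 2)) xv => // m u Vu; apply: T_iter.
Qed.

End RankOne.

(** * The universal module and the conclusion *)

Lemma universal_generated (K : fieldType) (n : nat) (phi : nat -> K)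
  (M : lmodType K) (rho : int -> M -> M) (w : M) :
  is_universal_Whittaker n phi rho w -> forall x, gen rho w 0 x.
Proof.
move=> [rhoP [wP univ]] x.
pose N := Subsp (@gen0 _ _ rho w 0) (@genZD _ _ rho w 0).
(* [actU] replaces [rho] because for k < -1 nothing keeps [rho k] inside the submodule. *)
have N_act k (v : sub_of N) : gen rho w 0 (actU rho k (val v)).
  have gv : gen rho w 0 (val v) by case: v => v v_in; exact: (elimT (subsp_predP N v)).
  rewrite /actU; case: ifP => le1; last exact: gen0.
  have := gen_U (leq0n (absz (k + 1))) gv; congr (gen rho w 0 (rho _ _)).
  by lia.
pose mk v (gv : gen rho w 0 v) : sub_of N := SubOf (introT (subsp_predP N v) gv).
pose sigma k v := mk _ (N_act k v).
have act_lin k : is_lin (actU rho k).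
  rewrite /actU; case: (-1 <= k); first by case: rhoP => lin _; apply: lin.
  by move=> a u v; rewrite scaler0 addr0.
have sigmaP : is_Omodule sigma.
  split=> [k a u v|i j le1i le1j v]; apply: val_inj; first exact: act_lin.
  change (actU rho i (actU rho j (val v)) - actU rho j (actU rho i (val v)) =
    (i - j)%:~R *: (val (actU sigma (i + j + 2) v) - 4 *: val (actU sigma (i + j) v))).
  have val_sigma k : val (actU sigma k v) = actU rho k (val v).
    by rewrite {1}/actU; case: ifP => [//|le1]; rewrite /actU le1.
  rewrite !val_sigma; case: rhoP => _ <- //.
  by rewrite /actU le1i le1j.
have w0P : is_Whittaker_vec n phi sigma (mk w (@gen_w _ _ rho w 0)).
  by move=> k le_nk; apply: val_inj; rewrite /= /actU /= wP.
(* The universal map into the submodule generated by w, followed by the inclusion, is the identity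
   by uniqueness. *)
have [f [[fP fr] fw _]] := univ _ _ _ sigmaP w0P.
have [g [_ _ g_uniq]] := univ _ _ _ rhoP wP.
have id_g : x = g x by apply: (g_uniq id).
have val_g : val (f x) = g x.
  apply: (g_uniq (fun y => val (f y))); last by rewrite fw.
  split=> [a u v|k v le1k]; first by rewrite fP.
  by rewrite fr //= /actU le1k.
by rewrite id_g -val_g; case: (f x) => v v_in; exact: (elimT (subsp_predP N v)).
Qed.

Lemma universal_neq0 (K : fieldType) (n : nat) (phi : nat -> K)
  (M : lmodType K) (rho : int -> M -> M) (w : M) :
  is_Lie_hom_Fn n phi -> is_universal_Whittaker n phi rho w -> w != 0.
Proof.
move=> phiP [_ [_ univ]].
have [|W [sigma [w' [sigmaP sw w'_neq0 _]]]] := @whittaker_module K n.+1 (phi \o predn).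
  move=> [|i] [|j] // le_ni le_nj; rewrite -(phiP i j le_ni le_nj).
  by rewrite addSn addnS addn2 /= -(@natr1 _ i) -(@natr1 _ j); ring.
have sP : is_Whittaker_vec n phi sigma w'.
  by move=> k le_nk; rewrite -[phi k]/((phi \o predn) k.+1) -sw //; congr sigma; lia.
have [f [[fP _] fw _]] := univ _ _ _ sigmaP sP.
by apply: contraNneq w'_neq0 => w0; rewrite -fw w0 (is_lin0 fP).
Qed.

Lemma irreducible_of_generator (K : fieldType) (M : lmodType K)
  (rho : int -> M -> M) (w : M) :
  w != 0 -> (forall x, gen rho w 0 x) ->
  (forall x S, x != 0 -> is_submodule rho S -> S x -> S w) -> Oirreducible rho.
Proof.
move=> w_neq0 gen_all Sw; split; first by exists w.
move=> S SP; have [[x [x_neq0 Sx]]|no_x] := EM (exists x, x != 0 /\ S x).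
  right=> v; apply: (gen_all v) => [|a u u'|i u _]; first exact: Sw Sx.
    exact: (submodule_ZD _ SP).
  exact: (submodule_U _ SP).
left=> v Sv; have [//|v_neq0] := eqVneq v 0.
by case: no_x; exists v.
Qed.

Theorem theorem6p6 (K : fieldType) (hK : [pchar K] =i pred0)
  (n : nat) (phi : nat -> K) (hphi : is_Lie_hom_Fn n phi)
  (M : lmodType K) (rho : int -> M -> M) (w : M)
  (hM : is_universal_Whittaker n phi rho w) :
  ((n = 0)%N -> (Oirreducible rho <-> phi 2%N != 4 * phi 0%N)) /\
  ((1 <= n)%N -> (Oirreducible rho <->
      (phi (2 * n + 1)%N != 4 * phi (2 * n - 1)%N) \/
      (phi (2 * n + 2)%N != 4 * phi (2 * n)%N))).
Proof.
have red := reducible_extension hK hphi hM.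
have gen_all := universal_generated hM.
have w_neq0 := universal_neq0 hphi hM.
have [rhoP [wP _]] := hM.
have irr := irreducible_of_generator w_neq0 gen_all.
split=> [n0 | n_gt0].
  subst n; split=> [irr_rho|phi_neq].
    by apply/eqP => phi2; apply: red irr_rho.
  apply: irr => x S x_neq0 SP; apply: (gen_irreducible_rank1 hK hphi rhoP wP) => //.
  by rewrite subr_eq0.
rewrite addn1 addn2 subn1; split=> [irr_rho|].
  have [odd_eq|] := eqVneq; last by left.
  by right; apply/eqP => even_eq; apply: red irr_rho.
have K_odd j : (2 * n < j)%N -> phi j.+2 = 4 * phi j by apply: phi_rec.
(* The top index c is 2n + 1 if the even equality fails, and 2n otherwise. *)
have [even_eq [odd_neq|/eqP //]|even_neq _] :=
  eqVneq (phi (2 * n).+2) (4 * phi (2 * n)%N).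
- apply: irr => x S x_neq0 SP.
  have phi_gt j : (2 * n < j)%N -> phi j.+1 = 4 * phi j.-1.
    rewrite leq_eqVlt => /predU1P[<- //|]; case: j => // j lt_j; exact: K_odd.
  have [Sw _] := gen_irreducible hK rhoP wP w_neq0 n_gt0 (leqnn _) (leqnSn _)
    odd_neq phi_gt (leq0n _) (gen_all x) x_neq0.
  exact: Sw.
- apply: irr => x S x_neq0 SP.
  have phi_gt j : ((2 * n).+1 < j)%N -> phi j.+1 = 4 * phi j.-1.
    by case: j => // j lt_j; exact: K_odd.
  have [Sw _] := gen_irreducible hK rhoP wP w_neq0 n_gt0 (leqnSn _) (leqnn _)
    even_neq phi_gt (leq0n _) (gen_all x) x_neq0.
  exact: Sw.
Qed.
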